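(* Let $\mathbf{X} = \{X_n\}_{n\in\mathbb{N}_0}$ be a Markov chain with values in a space $(\mathcal{S},\mathfrak{S})$. If there exists an irreducibility measure $\phi$ on $\mathfrak{S}$ for the chain $\mathbf{X}$, then there exists a unique maximal irreducibility measure $\psi$ on $\mathfrak{S}$, that is, a unique measure $\psi$ on $\mathfrak{S}$ such that (1) $\psi$ is an irreducibility measure for $\mathbf{X}$; (2) $\mu$ is an irreducibility measure for $\mathbf{X}$ if and only if $\mu \ll \psi$; and (3) if $A\in\mathfrak{S}$ is such that $\psi(A)=0$, then $\psi\{x : L(x,A)>0\}=0$.
   Context: $\mathbf{X}=\{X_n\}_{n\in\mathbb{N}_0}$ is a Markov chain with values in the measurable space $(\mathcal{S},\mathfrak{S})$, and $P_x$ denotes the law of the chain started at $X_0=x$. For $A\in\mathfrak{S}$ put $\tau_A := \inf\{n\ge 0 : X_n\in A\}$ (with $\inf\varnothing=\infty$) and, for $x\in\mathcal{S}$, $L(x,A) := P_x\{\tau_A<\infty\}$. A measure $\phi$ on $(\mathcal{S},\mathfrak{S})$ is called an irreducibility measure for $\mathbf{X}$ if for all $A\in\mathfrak{S}$, $\phi(A)>0$ implies $L(x,A)>0$ for all $x\in\mathcal{S}$. For measures $\mu,\psi$ on $\mathfrak{S}$, $\mu\ll\psi$ means that $\psi(A)=0$ implies $\mu(A)=0$ for every $A\in\mathfrak{S}$. The term ''maximal irreducibility measure'' is defined by the theorem itself: it is a measure $\psi$ with properties (1), (2) and (3).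
   Formalization: Uniqueness of the maximal irreducibility measure ψ is stated up to equivalence (mutual absolute continuity) instead of as literal equality, since ψ and 2ψ satisfy (1)–(3) together. *)

(* Defs.v *)
From HB Require Import structures.
From mathcomp Require Import all_boot all_order all_algebra.
From mathcomp Require Import all_classical all_reals all_analysis.

Set Implicit Arguments.
Unset Strict Implicit.
Unset Printing Implicit Defensive.
Import Order.TTheory GRing.Theory Num.Theory.
Import numFieldNormedType.Exports.

Local Open Scope classical_set_scope.
Local Open Scope ring_scope.
Local Open Scope ereal_scope.

(* sigma(X_0, ..., X_n) *)
Definition past dO d (O : measurableType dO) (S : measurableType d)
    (X : nat -> {mfun O >-> S}) (n : nat) : set (set O) :=
  <<s \bigcup_(k in `I_n.+1) preimage_set_system setT (X k) measurable >>.

(* A time-homogeneous Markov chain with its family of starting laws: P x is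
   the law under which X_0 = x, and under each P x the conditional probability
   of {X_(n+1) \in A} given sigma(X_0, ..., X_n) is K (X_n) A (expressed by
   integration over the events H of that sigma-algebra).
   The start at x is stated through \d_x because {x} need not be measurable. *)
Record markov_chain dO d (O : measurableType dO) (S : measurableType d)
    (R : realType) (K : R.-pker S ~> S) (X : nat -> {mfun O >-> S})
    (P : S -> probability O R) : Prop := MarkovChain {
  markov_start : forall (x : S) (A : set S), measurable A ->
    P x (X 0%N @^-1` A) = \d_x A ;
  markov_step : forall (x : S) (n : nat) (H : set O) (A : set S),
    past X n H -> measurable A ->
    P x (H `&` X n.+1 @^-1` A) = \int[P x]_(w in H) K (X n w) A }.

(* tau_A; it is +oo when A is never visited, as ereal_inf set0 = +oo *)
Definition hitting_time (R : realType) dO d (O : measurableType dO)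
    (S : measurableType d) (X : nat -> {mfun O >-> S}) (A : set S) (w : O)
    : \bar R :=
  ereal_inf [set n%:R%:E | n in [set n : nat | A (X n w)]].

Definition hit_prob dO d (O : measurableType dO) (S : measurableType d)
    (R : realType) (X : nat -> {mfun O >-> S}) (P : S -> probability O R)
    (x : S) (A : set S) : \bar R :=
  P x [set w | hitting_time R X A w < +oo].

(* No finiteness or nontriviality is imposed on phi. *)
Definition irreducibility_measure dO d (O : measurableType dO)
    (S : measurableType d) (R : realType) (X : nat -> {mfun O >-> S})
    (P : S -> probability O R) (phi : {measure set S -> \bar R}) : Prop :=
  forall A : set S, measurable A -> 0 < phi A ->
    forall x : S, 0 < hit_prob X P x A.

(* content_dominates psi mu means mu << psi. *)
Record maximal_irreducibility_measure dO d (O : measurableType dO)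
    (S : measurableType d) (R : realType) (X : nat -> {mfun O >-> S})
    (P : S -> probability O R) (psi : {measure set S -> \bar R}) : Prop :=
  MaximalIrreducibilityMeasure {
  maximal_irreducible : irreducibility_measure X P psi ;
  maximal_dominates : forall mu : {measure set S -> \bar R},
    irreducibility_measure X P mu <-> content_dominates psi mu ;
  maximal_null_hitting : forall A : set S, measurable A -> psi A = 0 ->
    psi [set x | 0 < hit_prob X P x A] = 0 }.

(* The conditions above depend only on the null sets of psi, so psi and 2 psi
   are maximal together: uniqueness can only hold up to this equivalence. *)
Definition equivalent_measures d (S : measurableType d) (R : realType)
    (mu nu : {measure set S -> \bar R}) : Prop :=
  content_dominates nu mu /\ content_dominates mu nu.

(* Main.v *)
(** Write [G A] for the set of [y] with [K y A > 0].  Integrating the Markov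
    property shows that [P x (X n \in A) > 0] iff [x \in G^n A], so
    [L(x, A) > 0] iff [x] lies in the measurable set [B A] of all [x] in some
    [G^n A]; as [G] commutes with countable unions, [B (B A) = B A].

    Since measures need not be finite, every sigma-ideal of measurable sets is
    the null ideal of a measure with values in [{0, +oo}].  Take for [psi] the
    measure whose null sets are those null for all irreducibility measures;
    (1) and (2) are then immediate.  For (3), if [mu] is an irreducibility
    measure, then so is the measure with null sets [{E | mu (B E) = 0}], because
    [mu (B E) > 0] gives access to [B E], hence to [E], from everywhere.  So
    [psi A = 0] forces [mu (B A) = 0] for each such [mu]. *)
Require Import Defs.
From mathcomp Require Import all_boot all_order all_algebra.
From mathcomp Require Import all_classical all_reals all_analysis.
From mathcomp Require Import measurable_realfun.
From HB Require Import structures.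

Set Implicit Arguments.
Unset Strict Implicit.
Unset Printing Implicit Defensive.
Import Order.TTheory GRing.Theory Num.Theory.

Local Open Scope classical_set_scope.
Local Open Scope ring_scope.

Section null_sets.
Context d (S : measurableType d) (R : realType).
Local Open Scope ereal_scope.

Lemma measure_gt0P (mu : {measure set S -> \bar R}) (A : set S) :
  0 < mu A <-> mu A <> 0.
Proof. by rewrite lt0e measure_ge0 andbT; split => /eqP. Qed.

Lemma measure_bigcup_eq0 (mu : {measure set S -> \bar R}) (F : (set S)^nat) :
  (forall n, measurable (F n)) -> (forall n, mu (F n) = 0) ->
  mu (\bigcup_n F n) = 0.
Proof.
move=> mF F0; apply/negligibleP; first exact: bigcup_measurable.
by apply/negligible_bigcup => n; apply/negligibleP; [exact: mF|exact: F0].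
Qed.

Lemma measure_bigcup_gt0 (mu : {measure set S -> \bar R}) (F : (set S)^nat) :
  (forall n, measurable (F n)) ->
  0 < mu (\bigcup_n F n) <-> exists n, 0 < mu (F n).
Proof.
move=> mF; split => [/measure_gt0P mu_neq0|[n mu_gt0]].
  apply: contrapT => /forallNP mu_eq0; apply: mu_neq0.
  apply: measure_bigcup_eq0 => // n.
  by apply: contrapT => /measure_gt0P; exact: mu_eq0.
apply: (lt_le_trans mu_gt0); apply: le_measure; rewrite ?inE//.
  exact: bigcup_measurable.
exact: bigcup_sup.
Qed.

(** [m] is 0 on [N] and +oo off it, for all sets at once, so the equivalence carries no
    measurability condition. *)
Lemma exists_measure_null_sets (N : set (set S)) :
  N set0 ->
  (forall A B, measurable A -> measurable B -> A `<=` B -> N B -> N A) ->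
  (forall F : (set S)^nat, (forall n, measurable (F n)) ->
    (forall n, N (F n)) -> N (\bigcup_n F n)) ->
  exists mu : {measure set S -> \bar R}, forall A, mu A = 0 <-> N A.
Proof.
move=> N0 Nsub Nbigcup.
pose m (A : set S) : \bar R := if `[< N A >] then 0 else +oo.
have m0 A : m A = 0 <-> N A by rewrite /m; case: asboolP.
have my A : ~ N A -> m A = +oo by rewrite /m; case: asboolP.
have m_ge0 A : 0 <= m A by rewrite /m; case: ifP.
have m_sigma : semi_sigma_additive m.
  move=> F mF _ mUF; apply: cvg_near_cst.
  (* If the union is in [N], every partial sum is 0. Otherwise some [F k] is outside [N], and every
     partial sum of more than [k] terms is +oo. *)
  have [NUF|NUF] := pselect (N (\bigcup_n F n)).
    near=> n; rewrite (m0 _).2// big1// => i _; apply/m0.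
    by apply: Nsub NUF => //; exact: bigcup_sup.
  have [k NFk] : exists k, ~ N (F k) by apply/existsNP => NF; exact/NUF/Nbigcup.
  exists k.+1 => //= n ltkn.
  rewrite my// big_mkord (bigD1 (Ordinal ltkn))//= my//.
  by rewrite addye// -ltNye (@lt_le_trans _ _ 0)// sume_ge0.
pose M := isMeasure.Build d S R m ((m0 _).2 N0) m_ge0 m_sigma.
pose mu : {measure set S -> \bar R} := HB.pack m M.
by exists mu.
Unshelve. all: by end_near. Qed.

End null_sets.

Section access.
Context d (S : measurableType d) (R : realType) (K : R.-pker S ~> S).
Local Open Scope ereal_scope.

(** The operator [G] of the sketch above. *)
Definition pre_access (A : set S) : set S := [set y | 0 < K y A].

(** The operator [B] of the sketch. The term [n = 0] is [A] itself, just as [hitting_time] counts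
    time 0. *)
Definition access (A : set S) : set S := \bigcup_n iter n pre_access A.

Lemma measurable_pre_access A : measurable A -> measurable (pre_access A).
Proof.
move=> mA; rewrite -[pre_access A]setTI.
exact: emeasurable_fun_o_infty (measurable_kernel K A mA) _.
Qed.

Lemma measurable_iter_pre_access n A :
  measurable A -> measurable (iter n pre_access A).
Proof. by move=> mA; elim: n => //= n; exact: measurable_pre_access. Qed.

Lemma measurable_access A : measurable A -> measurable (access A).
Proof.
by move=> mA; apply: bigcup_measurable => n _; exact: measurable_iter_pre_access.
Qed.

(** Each [K y] is a measure, so a countable union has positive mass iff one of its members does;
    iterate. *)
Lemma iter_pre_access_bigcup n (F : (set S)^nat) :
  (forall k, measurable (F k)) ->
  iter n pre_access (\bigcup_k F k) = \bigcup_k iter n pre_access (F k).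
Proof.
move=> mF; elim: n => //= n ->; apply/seteqP; split => x /=.
  move/measure_bigcup_gt0 => [k|k Kx]; first exact: measurable_iter_pre_access.
  by exists k.
move=> [k _ Kx]; apply/measure_bigcup_gt0; last by exists k.
by move=> j; exact: measurable_iter_pre_access.
Qed.

Lemma access_bigcup (F : (set S)^nat) : (forall k, measurable (F k)) ->
  access (\bigcup_k F k) = \bigcup_k access (F k).
Proof.
move=> mF; apply/seteqP; split => x.
  by move=> [n _]; rewrite iter_pre_access_bigcup// => -[k _ Fx]; exists k => //; exists n.
by move=> [k _ [n _ Fx]]; exists n => //; rewrite iter_pre_access_bigcup//; exists k.
Qed.

(** Once the union is pulled out, [n] steps into a set from which [A] is [k] steps away make [n + k]
    steps. *)
Lemma access_idem A : measurable A -> access (access A) = access A.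
Proof.
move=> mA; apply/seteqP; split => x; last by move=> Ax; exists 0%N.
rewrite {2}/access access_bigcup => [|k]; last exact: measurable_iter_pre_access.
by move=> [k _ [n _]]; rewrite -iterD => Ax; exists (n + k)%N.
Qed.

Lemma access_set0 : access set0 = set0.
Proof.
rewrite /access bigcup0// => n _; elim: n => //= n ->.
by apply/seteqP; split => x //=; rewrite /pre_access /= measure0 ltxx.
Qed.

Lemma accessS A B : measurable A -> measurable B -> A `<=` B ->
  access A `<=` access B.
Proof.
move=> mA mB AB x [n _ Ax]; exists n => //.
elim: n x Ax => [|n IHn] x //=; first exact: AB.
move=> /lt_le_trans; apply; apply: le_measure => //; rewrite inE;
  exact: measurable_iter_pre_access.
Qed.

End access.

Section chain.
Context (R : realType) (dO d : measure_display)
  (O : measurableType dO) (S : measurableType d)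
  (K : R.-pker S ~> S) (X : nat -> {mfun O >-> S})
  (P : S -> probability O R) (XP : markov_chain K X P).
Local Open Scope ereal_scope.

Lemma measurable_visit n A : measurable A -> measurable (X n @^-1` A).
Proof. by move=> mA; rewrite -[_ @^-1` _]setTI; exact: measurable_funP. Qed.

(** The Markov property over the whole space turns the left side into an integral of [K (X n w) A],
    which vanishes iff this nonnegative integrand is zero almost everywhere. *)
Lemma visit_succ_gt0 x n A : measurable A ->
  0 < P x (X n.+1 @^-1` A) <-> 0 < P x (X n @^-1` pre_access K A).
Proof.
move=> mA.
have mKA : measurable_fun setT (fun w => K (X n w) A).
  exact: measurableT_comp (measurable_kernel K A mA) _.
have -> : P x (X n.+1 @^-1` A) = \int[P x]_w K (X n w) A.
  rewrite -(markov_step XP) ?setTI//.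
  by rewrite -setC0 -setTD; apply: sigma_algebraCD; exact: sigma_algebra0.
have -> : X n @^-1` pre_access K A = [set w | K (X n w) A != 0].
  by apply/seteqP; split => w /=; rewrite /pre_access /= lt0e measure_ge0 andbT.
have -> : \int[P x]_w K (X n w) A = \int[P x]_w `|K (X n w) A|.
  by apply: eq_integral => w _; rewrite gee0_abs.
have mneq0 : measurable [set w | K (X n w) A != 0].
  by rewrite -[X in measurable X]setTI; exact: emeasurable_neq.
rewrite measure_gt0P lt0e integral_ge0// andbT.
have -> : (P x [set w | K (X n w) A != 0] = 0) <-> \int[P x]_w `|K (X n w) A| = 0.
  rewrite (ae_eq_integral_abs _ measurableT mKA) -negligibleP//.
  (* Almost-everywhere equality unfolds to negligibility of this complement. *)
  suff -> : [set w | K (X n w) A != 0] = ~` [set w | setT w -> K (X n w) A = cst 0 w] by [].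
  apply/seteqP; split => w /= => [/eqP KX0 /(_ I)//|KX0].
  by apply/eqP => KXA; exact: KX0.
by split => /eqP.
Qed.

(** The induction is over all [A]: each step trades one unit of time for one [pre_access], down to
    the Dirac law of [X 0]. *)
Lemma visit_gt0 x n A : measurable A ->
  0 < P x (X n @^-1` A) <-> iter n (pre_access K) A x.
Proof.
elim: n A => [|n IHn] A mA.
  rewrite (markov_start XP)// diracE lte_fin ltr0n lt0b /=.
  by split => [|Ax]; rewrite inE.
rewrite iterSr visit_succ_gt0// IHn//.
exact: measurable_pre_access.
Qed.

Lemma hit_prob_gt0 x A : measurable A -> 0 < hit_prob X P x A <-> access K A x.
Proof.
move=> mA; rewrite /hit_prob.
have -> : [set w | hitting_time R X A w < +oo] = \bigcup_n X n @^-1` A.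
  apply/seteqP; split => w /=.
    by move/ereal_inf_lt => [_ [n /= An <-] _]; exists n.
  move=> [n _ An]; apply: (@le_lt_trans _ _ n%:R%:E); last exact: ltry.
  by apply: ereal_inf_lbound; exists n.
rewrite measure_bigcup_gt0; last by move=> n; exact: measurable_visit.
split=> [[n]|[n _ Ax]]; first by move/visit_gt0 => Ax; exists n => //; exact: Ax.
by exists n; apply/visit_gt0.
Qed.

Lemma irreducible_access (mu : {measure set S -> \bar R}) :
  irreducibility_measure X P mu ->
  exists mu' : {measure set S -> \bar R}, irreducibility_measure X P mu' /\
    forall A, mu' A = 0 <-> mu (access K A) = 0.
Proof.
move=> irr; have [||| mu' mu'0] :=
  @exists_measure_null_sets _ S R [set A | mu (access K A) = 0].
- by rewrite /= access_set0 measure0.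
- move=> A B mA mB AB; apply: subset_measure0; last exact: accessS.
    exact: measurable_access.
  exact: measurable_access.
- move=> F mF F0 /=; rewrite access_bigcup//.
  apply: measure_bigcup_eq0 => n; last exact: F0.
  exact: measurable_access.
exists mu'; split=> // A mA /measure_gt0P mu'A x.
(* Idempotence reduces reaching [A] to reaching [access K A], which has positive [mu] measure. *)
apply/hit_prob_gt0 => //; rewrite -access_idem//.
apply/hit_prob_gt0; first exact: measurable_access.
apply: irr; first exact: measurable_access.
by apply/measure_gt0P => /mu'0.
Qed.

Lemma exists_maximal_irreducibility_measure :
  exists psi : {measure set S -> \bar R}, maximal_irreducibility_measure X P psi.
Proof.
have [||| psi psi0] := @exists_measure_null_sets _ S R
  [set A | forall mu : {measure set S -> \bar R},
    irreducibility_measure X P mu -> mu A = 0].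
- by move=> mu _; rewrite measure0.
- by move=> A B mA mB AB NB mu irr; apply: (subset_measure0 mA mB AB); exact: NB.
- move=> F mF NF mu irr; apply: measure_bigcup_eq0 => // n; exact: NF.
have psi_irr : irreducibility_measure X P psi.
  move=> A mA /measure_gt0P psiA x.
  (* Positive [psi] mass is witnessed by a single irreducibility measure [mu] charging [A], and [mu]
     alone gives the hitting bound. *)
  have /existsNP[mu /not_implyP[irr /measure_gt0P muA]] :
    ~ forall mu : {measure set S -> \bar R},
      irreducibility_measure X P mu -> mu A = 0 by move/psi0.
  exact: irr.
exists psi; split=> // [mu|A mA /psi0 NA].
  split=> [irr A mA /psi0|dom A mA /measure_gt0P muA]; first exact.
  by apply: psi_irr => //; apply/measure_gt0P => /(dom _ mA).
apply/psi0 => mu irr.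
have -> : [set x | 0 < hit_prob X P x A] = access K A.
  by apply/seteqP; split => x /hit_prob_gt0; exact.
have [mu' [irr' mu'0]] := irreducible_access irr.
by apply/mu'0; exact: NA.
Qed.

End chain.

Theorem theorem1 (R : realType) (dO d : measure_display)
    (O : measurableType dO) (S : measurableType d)
    (K : R.-pker S ~> S) (X : nat -> {mfun O >-> S})
    (P : S -> probability O R) (XP : markov_chain K X P) :
  (exists phi : {measure set S -> \bar R}, irreducibility_measure X P phi) ->
  exists psi : {measure set S -> \bar R},
    maximal_irreducibility_measure X P psi /\
    (forall psi' : {measure set S -> \bar R},
       maximal_irreducibility_measure X P psi' -> equivalent_measures psi' psi).
Proof.
move=> _; have [psi psi_max] := exists_maximal_irreducibility_measure XP.
(* Each of two maximal measures is an irreducibility measure, so (2) for the other one dominates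
   it. *)
exists psi; split=> // psi' psi'_max; split.
  exact/(maximal_dominates psi_max)/(maximal_irreducible psi'_max).
exact/(maximal_dominates psi'_max)/(maximal_irreducible psi_max).
Qed.
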